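(* Let $D$ be a noncommutative division ring of characteristic $2$, let $n$ be a nonnegative integer, and let $f, g \colon D \to D$ be additive maps. Suppose that $f(x) = x^n g(x^{-1})$ for all $x \in D^{\times}$. Then the following hold: (i) If $n = 2$, then $f = g$ and $f(x) = x f(1)$ for all $x \in D$; (ii) If $n \neq 2$, then $f = 0$ and $g = 0$.
   Context: Rings are associative with unity. $D^{\times}$ denotes the set of units of $D$, i.e. $D \setminus \{0\}$. A map $f \colon D \to D$ is additive if $f(x+y) = f(x) + f(y)$ for all $x, y \in D$. ''Noncommutative'' means that $D$ is not a field. No finite-dimensionality over the center is assumed. *)

(* Defs.v *)
From mathcomp Require Import all_boot all_algebra.

Set Implicit Arguments.
Unset Strict Implicit.
Unset Printing Implicit Defensive.

Import GRing.Theory.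
Local Open Scope ring_scope.

(* [GRing.field_axiom] only says that nonzero elements are units; a
   [unitRingType] need not be commutative. *)
Definition division_ring (D : unitRingType) : Prop := GRing.field_axiom D.

Definition noncommutative (D : unitRingType) : Prop :=
  ~ (forall x y : D, x * y = y * x).

(* Main.v *)
Require Import Defs.
From HB Require Import structures.
From mathcomp Require Import all_boot all_algebra.
From mathcomp Require Import finfield.
From Stdlib Require Import Classical_Prop Classical_Pred_Type.

Set Implicit Arguments.
Unset Strict Implicit.
Unset Printing Implicit Defensive.

Import GRing.Theory.
Local Open Scope ring_scope.

(** Let [c := f 1 = g 1], and for [n > 0] put
    [defect n x := (1 + x) ^+ n + x ^+ n + 1], a polynomial in [x] over the
    prime field which vanishes identically when [n] is a power of 2.  Hua's
    identity, applied to commuting [a] and [b], gives ([hua_commuting])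
      [f (a * a * b) = defect n (a * b) * f a + a ^+ n * g b],
    hence [f (x * x) = defect n x * f x + x ^+ n * c] and
    [f x + g x = defect n x * c].  Two facts follow: [c = 0] forces [f = 0]
    ([vanish]), and [n <> 2] forces [c = 0] ([value_at1]).  They settle
    the case [n <> 2] at once, and the case [n = 2] after subtracting the
    solution [x |-> x * c] from [f] and [g].  The exponent 0 has a short
    argument of its own ([exponent0_vanish]).

    If [n] is a power of 2 and [c = 0], then [f = g] kills squares, hence
    commutators, hence is invariant under conjugation; comparing
    [f z = z ^+ n * f z^-1] with its conjugates shows that [z ^+ n] is central
    whenever [f z != 0].  Division rings have no room for this: if [b] is
    noncentral with [b ^+ 2 ^ k] central, there is [y] such that neither
    [y ^+ 2 ^ k] nor [(y + b) ^+ 2 ^ k] is central ([radical_escape]).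

    For [n = 1], a direct computation with a square of a commutator gives
    [c = 0].  In the other cases there is a dichotomy.
    - Some nonzero central [z] is not a root of unity.  Replacing variables by
      their multiples by powers of [z] separates polynomial identities into
      homogeneous parts ([scaling_separates_coefs]).  In each case the part of
      degree one in [y] of [(x + y) ^+ q] has to vanish, [q] being a power of
      2; this makes every [x ^+ q] central, and [radical_escape] applies again.
    - All nonzero central elements are roots of unity.  By Jacobson's theorem
      ([all_torsion_commutative]) some [t] is not a root of unity, and then the
      powers of [t] are independent over the center.  Call [h : D -> D] of
      degree [< e] when all its [e]-fold differences vanish.  The element [t]
      makes multiplication by [x] raise the degree by exactly one
      ([degree_lt_divX]), as it would for polynomials.  But [f] and [f + g]
      have degree [< 2], and [x |-> f (x * x)] has degree [< 3], while the
      formulas above give them leading terms [x ^+ d * f x], [x ^+ d * c] or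
      [x ^+ n * c] of larger degree; so [f] or [c] is zero. *)

(** * Finite subrings of division rings *)

Section Wedderburn.
Context (D : unitRingType) (divD : division_ring D).

Lemma division_mulf_eq0 (x y : D) : x * y = 0 -> x = 0 \/ y = 0.
Proof.
move=> xy0; have [->|x0] := eqVneq x 0; first by left.
by right; apply: (mulrI (divD x0)); rewrite xy0 mulr0.
Qed.

(** Wedderburn's little theorem, for a finite subring given by the list of its
    elements: that list carries a finite ring structure without zero
    divisors. *)
Lemma finite_subring_commutative (S : seq D) :
  subring_closed (mem S) -> {in S &, forall x y, x * y = y * x}.
Proof.
move=> ringS x y xS yS.
pose T : nzRingType := HB.pack (seq_sub S)
  (GRing.SubChoice_isSubNzRing.Build D _ (seq_sub S) ringS).
pose T' : finNzRingType := HB.pack T (seq_sub_isCountable S) (seq_sub_isFinite S).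
pose F : finUnitRingType := HB.pack T' (FinRing.isNzRing.Build T').
have domF : forall u v : F, u * v = 0 -> (u == 0) || (v == 0).
  move=> u v uv0; have /division_mulf_eq0 [u0|v0] : val u * val v = 0.
  - by have := congr1 val uv0.
  - by apply/orP; left; apply/eqP/val_inj.
  - by apply/orP; right; apply/eqP/val_inj.
by have := congr1 val (finDomain_mulrC domF (SeqSub xS) (SeqSub yS)).
Qed.
End Wedderburn.

(** * Characteristic two *)

Section Char2.
Context (D : unitRingType) (divD : division_ring D) (charD : 2%N \in [pchar D]).

Lemma add2 (x : D) : x + x = 0. Proof. exact: addrr_pchar2. Qed.
Lemma opp2 (x : D) : - x = x. Proof. exact: oppr_pchar2. Qed.
Lemma add2K (x y : D) : x + (x + y) = y. Proof. by rewrite addrA add2 add0r. Qed.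
Lemma eq_add2 (x y : D) : x + y = 0 -> x = y.
Proof. by move/eqP; rewrite addr_eq0 opp2 => /eqP. Qed.
End Char2.

(** Proves an equality between two sums whose terms cancel in pairs: both sides
    are added up, then the leading term is repeatedly carried to its twin. *)
Ltac cancel2 D charD :=
  apply: (@eq_add2 D charD); rewrite -?addrA ?addr0;
  repeat match goal with
   | |- ?x + ?x = _ => rewrite (@add2 D charD x)
   | |- ?x + (?x + ?r) = _ => rewrite (@add2K D charD x r)
   | |- ?x + ?r = _ => match r with
       | context [?y + (x + ?s)] => rewrite (addrCA y x s)
       | context [?y + x] => rewrite (addrC y x) end
   end;
  rewrite ?addr0 ?add0r; try by [].

(** * Roots of unity and Jacobson's theorem *)

Section Torsion.
Context (D : unitRingType) (divD : division_ring D) (charD : 2%N \in [pchar D]).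

Let unitD (x : D) : x != 0 -> x \is a GRing.unit. Proof. exact: divD. Qed.

Definition central (z : D) := forall x : D, z * x = x * z.
Definition torsion (x : D) := exists2 m, (0 < m)%N & x ^+ m = 1.

(** Two powers of [x] coincide, by the pigeonhole principle. *)
Lemma finite_subring_torsion (S : seq D) (x : D) :
  subring_closed (mem S) -> x \in S -> x != 0 -> torsion x.
Proof.
move=> [S1 _ SM] xS x0.
pose s := mkseq (fun i => x ^+ i) (size S).+1.
have sS : {subset s <= S}.
  move=> _ /mapP[i _ ->]; elim: i => [|i IHi]; first by rewrite expr0.
  by rewrite exprS; apply: SM.
have /(uniqPn 0)[i [j [ltij]]] : ~~ uniq s.
  by apply/negP => /uniq_leq_size/(_ sS); rewrite size_mkseq ltnn.
rewrite size_mkseq => ltj; rewrite !nth_mkseq ?(ltn_trans ltij) // => eij.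
exists (j - i)%N; first by rewrite subn_gt0.
apply: (mulIr (unitrX i (unitD x0))).
by rewrite -exprD subnK ?mul1r // ltnW.
Qed.

(** The combinations [\sum_(i < N) c i * u ^+ i] form a finite ring because [u]
    can be moved across coefficients and [u ^+ N] can be rewritten.  This
    covers three adjunctions: of a commuting root of unity, of an element
    algebraic over a central finite ring, and of a root of unity which
    normalizes [S] without centralizing it. *)
Lemma finite_subring_adjoin (S : seq D) (u : D) (N : nat) (a : nat -> D) :
  subring_closed (mem S) -> u != 0 -> (0 < N)%N ->
  {in S, forall s, u * s * u^-1 \in S} -> (forall i, a i \in S) ->
  u ^+ N = \sum_(i < N) a i * u ^+ i ->
  exists S' : seq D, [/\ subring_closed (mem S'), {subset S <= S'}, u \in S' &
    {in S', forall x, exists2 c : nat -> D, forall i, c i \in S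
                    & x = \sum_(i < N) c i * u ^+ i}].
Proof.
move=> ringS u0 N0 normS aS uN; have Uu := unitD u0.
have [S1 SB SM] := ringS; have S0 : 0 \in S by rewrite -(subrr 1) SB.
have SD x y : x \in S -> y \in S -> x + y \in S.
  by move=> xS yS; rewrite -[y]opprK SB // -sub0r SB.
pose comb (f : {ffun 'I_N -> seq_sub S}) := \sum_i val (f i) * u ^+ i.
have memP x : reflect (exists2 c : nat -> D, forall i, c i \in S
                    & x = \sum_(i < N) c i * u ^+ i) (x \in codom comb).
  apply: (iffP codomP) => [[f ->]|[c cS ->]].
    exists (fun i => if insub i is Some j then val (f j) else 0) => [i|].
      by case: insubP => // j _ _; apply: valP.
    by apply: eq_bigr => i _; rewrite valK.
  exists [ffun i : 'I_N => SeqSub (cS i)].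
  by apply: eq_bigr => i _; rewrite ffunE.
have LS x s : s \in S -> x \in codom comb -> s * x \in codom comb.
  move=> sS /memP[c cS ->]; apply/memP; exists (fun i => s * c i) => [i|].
    exact: SM.
  by rewrite mulr_sumr; apply: eq_bigr => i _; rewrite mulrA.
have LB x y : x \in codom comb -> y \in codom comb -> x - y \in codom comb.
  move=> /memP[c cS ->] /memP[d dS ->]; apply/memP.
  exists (fun i => c i - d i) => [i|]; first exact: SB.
  by rewrite -sumrB; apply: eq_bigr => i _; rewrite mulrBl.
have L0 : 0 \in codom comb.
  by apply/memP; exists (fun=> 0) => // ; rewrite big1 // => i _; rewrite mul0r.
have LD x y : x \in codom comb -> y \in codom comb -> x + y \in codom comb.
  by move=> xL yL; rewrite -[y]opprK LB // -sub0r LB.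
have LU x : x \in codom comb -> u * x \in codom comb.
  move=> /memP[c cS ->]; apply/memP.
  case: N N0 uN {comb memP LS LB L0 LD} => // N _ uN.
  pose b i := u * c i * u^-1; have bS i : b i \in S by apply: normS.
  exists (fun i => (if i is j.+1 then b j else 0) + b N * a i) => [i|].
    by apply: SD; [case: i | apply: SM].
  rewrite mulr_sumr (eq_bigr (fun i : 'I_N.+1 => b i * u ^+ i.+1)); last first.
    by move=> i _; rewrite /b exprS !mulrA divrK.
  rewrite big_ord_recr /= uN mulr_sumr.
  under [RHS]eq_bigr do rewrite mulrDl -mulrA.
  by rewrite big_split /= [X in _ = X + _]big_ord_recl /= mul0r add0r.
have LX x i : x \in codom comb -> u ^+ i * x \in codom comb.
  by move=> xL; elim: i => [|i IHi]; rewrite ?mul1r // exprS -mulrA LU.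
have SL : {subset S <= codom comb}.
  move=> s sS; apply/memP; case: N N0 {uN comb memP LS LB L0 LD LU LX} => // N _.
  exists (fun i => if i is 0%N then s else 0); first by case.
  by rewrite big_ord_recl mulr1 big1 ?addr0 // => i _; rewrite mul0r.
exists (codom comb); split=> //; last by move=> x /memP.
  split=> [||x y xL yL]; [exact: SL | exact: LB |].
  move/memP: xL => [c cS ->]; rewrite mulr_suml; elim/big_ind: _ => // i _.
  by rewrite -mulrA LS // LX.
by rewrite -[u]mulr1 LU // SL.
Qed.

Lemma prime_subring : subring_closed (mem [:: 0; 1 : D]).
Proof.
split; first by rewrite !inE eqxx orbT.
  move=> x y; rewrite !inE => /pred2P[]-> /pred2P[]->;
  by rewrite ?subrr ?subr0 ?sub0r ?(opp2 charD) eqxx ?orbT.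
by move=> x y; rewrite !inE => /pred2P[]-> /pred2P[]->; rewrite ?(mul0r, mul1r) eqxx ?orbT.
Qed.

(** Conjugation by [x] has finite order [m], the order of [x], and [m] is odd
    since [x ^+ 2 = 1] forces [x = 1].  Hence [y] is the sum of its components
    [v k := \sum_i x ^+ (k * i) * y * x ^- i], which satisfy
    [v k * x = x ^+ k * v k].  If only those with [x ^+ k = x] were nonzero,
    [y] would commute with [x]. *)
Lemma twisted_eigenvector (x y : D) : torsion x -> x * y != y * x ->
  exists k u, [/\ u != 0, u * x = x ^+ k * u & x ^+ k != x].
Proof.
move=> tx nxy; have /ex_minnP[m /andP[m0 /eqP xm] minm] : exists m, (0 < m)%N && (x ^+ m == 1).
  by case: tx => m m0 xm; exists m; rewrite m0 xm eqxx.
have ord i : (0 < i < m)%N -> x ^+ i != 1.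
  case/andP=> i0 ltim; apply/eqP => xi; have := minm i.
  by rewrite i0 xi eqxx leqNgt ltim => /(_ isT).
have x0 : x != 0 by apply: contraNneq nxy => ->; rewrite mul0r mulr0.
have Ux := unitD x0.
have oddm : odd m.
  apply/negPn/negP => evm; pose h := m./2.
  have mE : m = (h + h)%N by rewrite addnn even_halfK.
  have h0 : (0 < h)%N by move: m0; rewrite mE; case: (h).
  have /negP[] : x ^+ h != 1 by apply: ord; rewrite h0 mE -addn1 leq_add2l.
  have /(division_mulf_eq0 divD) : (x ^+ h + 1) * (x ^+ h + 1) = 0.
    rewrite mulrDl mulrDr -exprD -mE xm mulr1 mul1r.
    by rewrite addrACA [_ + 1]addrC (add2 charD).
  by case=> /(eq_add2 charD) ->.
pose v k := \sum_(i < m) x ^+ (k * i) * y * x^-1 ^+ i.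
have vx k : v k * x = x ^+ k * v k.
  case: m m0 xm {minm ord oddm} @v => // m _ xm v.
  rewrite /v mulr_suml mulr_sumr big_ord_recl big_ord_recr /= [RHS]addrC; congr (_ + _).
    rewrite muln0 !expr0 mul1r mulr1 !mulrA -exprD -mulnS mulnC exprM xm expr1n mul1r.
    rewrite exprVn; congr (_ * _); apply: (mulIr (unitrX m Ux)).
    by rewrite -exprS xm mulVr ?unitrX.
  apply: eq_bigr => i _; rewrite /bump add1n [_ ^+ i.+1]exprSr mulrA mulrVK // mulnS exprD.
  by rewrite !mulrA.
(* orthogonality of the powers of [x]; the odd multiple [m] of [y] is [y] *)
have sumv : \sum_(k < m) v k = y.
  rewrite exchange_big /= (bigD1 (Ordinal m0)) //= [X in _ + X]big1 ?addr0 => [|i ni0].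
    under eq_bigr => k _ do rewrite /= muln0 !expr0 mul1r mulr1.
    rewrite sumr_const card_ord -[m]odd_double_half oddm mulrnDr -muln2 mulnC mulrnA.
    by rewrite mulr2n (add2 charD) mul0rn addr0.
  under eq_bigr do rewrite mulnC exprM.
  rewrite -!mulr_suml; have := ord i.
  rewrite lt0n ltn_ord andbT => /(_ ni0) xi.
  suff -> : \sum_(k < m) (x ^+ i) ^+ k = 0 by rewrite !mul0r.
  have := subrX1 (x ^+ i) m; rewrite -exprM mulnC exprM xm expr1n subrr.
  move/esym/(division_mulf_eq0 divD) => [] // /eqP.
  by rewrite subr_eq0 (negPf xi).
have /existsP[k /andP[vk xk]] : [exists k : 'I_m, (v k != 0) && (x ^+ k != x)].
  apply/contraT => /existsPn nv; have /negP[] := nxy.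
  rewrite eq_sym -sumv mulr_suml mulr_sumr; apply/eqP/eq_bigr => k _; have := nv k.
  by rewrite vx negb_and !negbK => /orP[]/eqP-> //; rewrite !mulr0.
by exists k, (v k); split.
Qed.

(** Jacobson's theorem.  Otherwise some [u] satisfies [u * x = x ^+ k * u] with
    [x ^+ k != x]; since [x] and [u] are roots of unity they lie in a finite
    subring, which is commutative. *)
Lemma all_torsion_commutative :
  (forall x : D, x != 0 -> torsion x) -> forall x y : D, x * y = y * x.
Proof.
move=> tors x y; apply/eqP; apply/contraT => nxy.
have x0 : x != 0 by apply: contraNneq nxy => ->; rewrite mul0r mulr0.
have [k [u [u0 ux xk]]] := twisted_eigenvector (tors x x0) nxy.
have delta0 (S : seq D) N (w : D) : subring_closed (mem S) -> (0 < N)%N -> w ^+ N = 1 ->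
    (forall i, (i == 0)%N%:R \in S) /\ w ^+ N = \sum_(i < N) (i == 0 :> nat)%:R * w ^+ i.
  move=> [S1 SB _] + ->; case: N => // N _; split=> [i|].
    by case: (i == 0)%N; rewrite /= ?mulr0n ?mulr1n // -(subrr 1) SB.
  by rewrite big_ord_recl mulr1 big1 ?addr0 // => i _; rewrite mul0r.
have [m m0 xm] := tors x x0; have [M M0 uM] := tors u u0.
have [dS sm] := delta0 _ _ _ prime_subring m0 xm.
have [|S1 [ringS1 _ xS1 S1P]] :=
    finite_subring_adjoin prime_subring x0 m0 _ dS sm.
  by move=> s; rewrite !inE => /pred2P[]->; rewrite ?(mulr0, mulr1) ?mul0r ?divrr ?unitD ?eqxx ?orbT.
have [S11 S1B S1M] := ringS1.
have S10 : 0 \in S1 by rewrite -(subrr 1) S1B.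
have S1D a b : a \in S1 -> b \in S1 -> a + b \in S1.
  by move=> aS bS; rewrite -[b]opprK S1B // -sub0r S1B.
have S1X a i : a \in S1 -> a ^+ i \in S1.
  by move=> aS; elim: i => [|i IHi]; rewrite ?expr0 // exprS S1M.
have uxi i : u * x ^+ i = (x ^+ k) ^+ i * u.
  by elim: i => [|i IHi]; rewrite ?mul1r ?mulr1 // !exprSr mulrA IHi -mulrA ux mulrA.
have [dS1 sM] := delta0 _ _ _ ringS1 M0 uM.
have [|S2 [ringS2 S12 uS2 _]] :=
    finite_subring_adjoin ringS1 u0 M0 _ dS1 sM.
  move=> _ /S1P[c cS ->]; rewrite mulr_sumr mulr_suml.
  elim/big_ind: _ => // i _; have -> : u * (c i * x ^+ i) * u^-1 = c i * (x ^+ k) ^+ i.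
    rewrite mulrA; have -> : u * c i = c i * u.
      by have := cS i; rewrite !inE => /pred2P[]->; rewrite ?(mul0r, mulr0, mul1r, mulr1).
    by rewrite -[c i * u * _]mulrA uxi mulrA mulrK ?unitD.
  apply: S1M; last by rewrite S1X ?S1X.
  by have := cS i; rewrite !inE => /pred2P[]->.
have := finite_subring_commutative divD ringS2 uS2 (S12 _ xS1).
rewrite ux => /(mulIr (unitD u0)) xkx.
by rewrite xkx eqxx in xk.
Qed.

End Torsion.

(** * Functional identities and the degree of a function *)

Section Degree.
Context (D : unitRingType) (divD : division_ring D) (charD : 2%N \in [pchar D]).
Let unitD (x : D) : x != 0 -> x \is a GRing.unit. Proof. exact: divD. Qed.

Definition transcendental (t : D) := forall N (z : nat -> D),
  (forall i, central (z i)) -> \sum_(i < N) z i * t ^+ i = 0 ->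
  forall i, (i < N)%N -> z i = 0.

Fixpoint del_nth (j : nat) (s : seq D) : seq D :=
  match s, j with
  | [::], _ => [::]
  | _ :: s', 0 => s'
  | y :: s', j'.+1 => y :: del_nth j' s'
  end.

Lemma size_del_nth j s : (j < size s)%N -> size (del_nth j s) = (size s).-1.
Proof.
elim: s j => // y s IHs [|j] //= ltj; rewrite IHs //.
by case: (s) ltj.
Qed.

(** Artin's argument, by induction on [N]: normalize the last nonzero
    coefficient to [-1]; replacing [x] by [x * y] and subtracting the identity
    multiplied by [y] gives a shorter identity, whose coefficients are the
    commutators of the [c i] with [y].  So the [c i] are central, and [x := 1]
    is a dependence between powers of [t]. *)
Lemma powers_separate_coefs (t : D) : transcendental t -> forall N (c : nat -> D),
  (forall x, \sum_(i < N) t ^+ i * x * c i = 0) -> forall i, (i < N)%N -> c i = 0.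
Proof.
move=> trt; elim=> // N IHN c Hc.
have [cN0|cN0] := eqVneq (c N) 0.
  move=> i; rewrite ltnS leq_eqVlt => /predU1P[->//|]; apply: IHN => x.
  by have := Hc x; rewrite big_ord_recr /= cN0 mulr0 addr0.
pose e i := c i * (c N)^-1.
have He x : \sum_(i < N) t ^+ i * x * e i = - (t ^+ N * x).
  apply/eqP; rewrite -addr_eq0; apply/eqP/(mulIr (unitD cN0)).
  rewrite mul0r mulrDl mulr_suml -[RHS](Hc x) big_ord_recr /=; congr (_ + _).
  by apply: eq_bigr => i _; rewrite /e -!mulrA mulVr ?mulr1 ?unitD.
clearbody e; have ez i : (i < N)%N -> central (e i).
  move=> ltiN y; apply/eqP; rewrite eq_sym -subr_eq0; apply/eqP.
  apply: (IHN (fun i => y * e i - e i * y)) => // x.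
  under eq_bigr do rewrite mulrBr !mulrA -[_ * x * y]mulrA.
  by rewrite sumrB -mulr_suml !He mulNr mulrA subrr.
have : (1 : D) = 0.
  pose z i := if (i < N)%N then e i else 1.
  have <- : z N = 1 by rewrite /z ltnn.
  apply: (trt N.+1) => // [i|].
    by rewrite /z; case: ifP => [/ez//|_] x; rewrite mul1r mulr1.
  rewrite big_ord_recr /= {2}/z ltnn mul1r.
  under eq_bigr => i _.
    rewrite /z ltn_ord; have -> : e i * t ^+ i = t ^+ i * 1 * e i.
      by rewrite mulr1 ez.
    over.
  by rewrite He mulr1 addNr.
by move/eqP; rewrite oner_eq0.
Qed.

(** Substituting [t * x] for the first
    variable and subtracting [t] times the original identity removes the terms
    in which that variable stands in front; the others give an identity of
    the same shape with one variable less and one power of [t] more.  By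
    induction they vanish, and [powers_separate_coefs] handles the terms that
    remain. *)
Lemma one_sided_functional_identity (t : D) : transcendental t ->
  forall d m (F : nat -> nat -> seq D -> D),
  (forall s, size s = d.+1 ->
     \sum_(j < d.+1) \sum_(i < m.+1) t ^+ i * s`_j * F i j (del_nth j s) = 0) ->
  forall i j s, (i <= m)%N -> (j <= d)%N -> size s = d -> F i j s = 0.
Proof.
move=> trt; elim=> [|d IHd] m F HF.
  move=> i [|//] [|//] lei _ _; apply: (powers_separate_coefs trt _ (N := m.+1) (c := fun i => F i 0%N [::])) => // x.
  by have := HF [:: x] erefl; rewrite big_ord1.
have tail i j x s : (i <= m)%N -> (j <= d)%N -> size s = d -> F i j.+1 (x :: s) = 0.
  move=> lei lej sz.
  (* the coefficients of the identity left after the substitution *)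
  pose G x i j s := (if (i <= m)%N then F i j.+1 (t * x :: s) else 0)
                  + (if i is i'.+1 then F i' j.+1 (x :: s) else 0).
  have G0 x' i' : (i' <= m.+1)%N -> G x' i' j s = 0.
    move=> lei'; apply: (IHd m.+1 (G x')) => // {i lei i' lei' j lej} s' sz'.
    have := HF (t * x' :: s') (congr1 S sz'); have := HF (x' :: s') (congr1 S sz').
    rewrite [X in X = 0 -> _]big_ord_recl [X in _ -> X = 0 -> _]big_ord_recl /=.
    set A := (X in X + _ = 0 -> _); set B := (X in _ + X = 0 -> _).
    set tA := (X in _ -> X + _ = 0 -> _); set C := (X in _ -> _ + X = 0 -> _).
    have -> : tA = t * A.
      by rewrite /tA /A mulr_sumr; apply: eq_bigr => i _; rewrite !mulrA -exprS exprSr.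
    move=> /(congr1 (fun u => t * u)); rewrite mulr0 mulrDr => h h'.
    have tB : t * B = C by apply: (addrI (t * A)); rewrite h h'.
    rewrite -[RHS](add2 charD C) -{2}tB {tB h h'}.
    rewrite /C /B mulr_sumr -big_split; apply: eq_bigr => j _ /=.
    under eq_bigr => i _ do rewrite mulrDr.
    rewrite big_split /=; congr (_ + _).
      rewrite big_ord_recr /= ltnn mulr0 addr0; apply: eq_bigr => i _.
      by rewrite -ltnS ltn_ord.
    rewrite big_ord_recl /= mulr0 add0r mulr_sumr; apply: eq_bigr => i _.
    by rewrite !mulrA -exprS.
  (* the top coefficient involves only one value, the next ones follow *)
  have [p] := ubnP (m - i). elim: p i lei x => [i lei x|p IHp i lei x ltp]; first by rewrite ltn0.
  have := G0 x i.+1 lei; rewrite /G; case: ifP => [ltim|_]; last by rewrite add0r.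
  by rewrite (IHp i.+1) ?add0r //; apply: leq_trans (ltn_sub2l ltim (ltnSn i)) _.
move=> i [|j] s lei lej sz; last by case: s sz => // x s [sz]; apply: tail.
apply: (powers_separate_coefs trt _ (N := m.+1) (c := fun i => F i 0%N s)) => // x.
have := HF (x :: s) (congr1 S sz); rewrite big_ord_recl /= [X in _ + X]big1 ?addr0 // => k _.
by rewrite big1 // => i' _; rewrite tail ?mulr0 ?size_del_nth ?sz ?ltn_ord // -ltnS ltn_ord.
Qed.

(** The iterated difference of [h] at [x] along the increments in [s]; signs
    are immaterial in characteristic 2. *)
Fixpoint diff (s : seq D) (h : D -> D) (x : D) : D :=
  if s is y :: s' then diff s' h (x + y) + diff s' h x else h x.

Definition degree_lt (e : nat) (h : D -> D) :=
  forall s, size s = e -> forall x, diff s h x = 0.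

Lemma diff_eq s h k x : h =1 k -> diff s h x = diff s k x.
Proof. by move=> hk; elim: s x => [|y s IHs] x /=; rewrite ?hk ?IHs. Qed.

Lemma degree_lt_eq e h k : h =1 k -> degree_lt e h -> degree_lt e k.
Proof. by move=> hk He s sz x; rewrite -(diff_eq _ _ hk) He. Qed.

Lemma degree_ltW e e' h : (e <= e')%N -> degree_lt e h -> degree_lt e' h.
Proof.
move=> /subnK <-; elim: (e' - e)%N => // i IHi He [|y s] //= [sz] x.
by rewrite !IHi ?addr0.
Qed.

Lemma degree_ltD e h k :
  degree_lt e h -> degree_lt e k -> degree_lt e (fun x => h x + k x).
Proof.
move=> Hh Hk s sz x; transitivity (diff s h x + diff s k x).
  elim: s x {sz} => //= y s IHs x; rewrite !IHs; exact: addrACA.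
by rewrite Hh // Hk // addr0.
Qed.

Lemma degree_lt_sum (I : Type) (r : seq I) (p : pred I) e (h : I -> D -> D) :
  (forall i, p i -> degree_lt e (h i)) ->
  degree_lt e (fun x => \sum_(i <- r | p i) h i x).
Proof.
move=> Hh; elim: r => [|i r IHr].
  apply: (degree_lt_eq (h := fun=> 0)) => [x|s _ x]; first by rewrite big_nil.
  by elim: s x => //= y s IHs x; rewrite !IHs addr0.
case pi: (p i); last by apply: degree_lt_eq IHr => x; rewrite big_cons pi.
by apply: degree_lt_eq (degree_ltD (Hh _ pi) IHr) => x; rewrite big_cons pi.
Qed.

Lemma degree_lt_natl e m h : degree_lt e h -> degree_lt e (fun x => m%:R * h x).
Proof.
move=> Hh s sz x; transitivity (m%:R * diff s h x); last by rewrite Hh ?mulr0.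
by elim: s x {sz} => //= y s IHs x; rewrite !IHs mulrDr.
Qed.

Lemma degree_lt_cst c : degree_lt 1 (fun=> c).
Proof. by case=> [|y []] //= _ x; apply: add2. Qed.

Lemma degree_lt_additive (f : D -> D) :
  {morph f : x y / x + y} -> degree_lt 2 f.
Proof.
move=> fD; case=> [|y [|z []]] //= _ x; rewrite !fD; cancel2 D charD.
Qed.

Lemma diff_shift s h y x :
  diff s h (x + y) + diff s h x = diff s (fun x => h (x + y) + h x) x.
Proof.
elim: s x => //= z s IHs x; rewrite -!IHs [x + y + z]addrAC; exact: addrACA.
Qed.

(** The first difference of [x |-> f (x * x)] is additive up to a constant. *)
Lemma degree_lt_additive_square (f : D -> D) :
  {morph f : x y / x + y} -> degree_lt 3 (fun x => f (x * x)).
Proof.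
move=> fD [|y s] //= [sz] x; rewrite diff_shift.
have lin : degree_lt 2 (fun x => f (x * y + y * x) + f (y * y)).
  apply: degree_ltD; last exact: degree_ltW (degree_lt_cst _).
  by apply: degree_lt_additive => u v; rewrite mulrDl mulrDr -fD addrACA.
rewrite -[RHS](lin s sz x); apply: diff_eq => {}x.
by rewrite mulrDl !mulrDr !fD; cancel2 D charD.
Qed.

(** The Leibniz rule for iterated differences, which involves the increments
    one at a time because [x |-> x] is additive. *)
Lemma diff_mulX s k x : diff s (fun x => x * k x) x =
  x * diff s k x + \sum_(j < size s) s`_j * (diff (del_nth j s) k x + diff s k x).
Proof.
elim: s x => [|y s IHs] x /=; first by rewrite big_ord0 addr0.
rewrite !IHs big_ord_recl /= mulrDl.
under [in RHS]eq_bigr => j _.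
  have -> : diff (del_nth j s) k (x + y) + diff (del_nth j s) k x +
    (diff s k (x + y) + diff s k x) =
    (diff (del_nth j s) k (x + y) + diff s k (x + y)) + (diff (del_nth j s) k x + diff s k x).
    exact: addrACA.
  rewrite mulrDr add0n; over.
rewrite big_split /= mulrDr.
have -> : diff s k x + (diff s k (x + y) + diff s k x) = diff s k (x + y).
  by rewrite addrCA (add2 charD) addr0.
pose A z := \sum_(j < size s) s`_j * (diff (del_nth j s) k z + diff s k z).
by rewrite -!/(A _); cancel2 D charD.
Qed.

Lemma degree_lt_mulX e k : degree_lt e k -> degree_lt e.+1 (fun x => x * k x).
Proof.
move=> Hk s sz x; have Hk' := degree_ltW (leqnSn e) Hk.
rewrite diff_mulX Hk' // mulr0 add0r big1 // => j _.
by rewrite Hk ?add0r ?mulr0 // size_del_nth ?ltn_ord // sz.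
Qed.

Lemma degree_lt_mulXn e i k :
  degree_lt e k -> degree_lt (i + e) (fun x => x ^+ i * k x).
Proof.
move=> Hk; elim: i => [|i IHi].
  by apply: degree_lt_eq Hk => x; rewrite mul1r.
by apply: degree_lt_eq (degree_lt_mulX IHi) => x; rewrite mulrA exprS.
Qed.

(** By [diff_mulX], the vanishing of the differences of order [e.+1] of
    [x |-> x * k x] reads [\sum_j s`_j * diff (del_nth j s) k x = 0], where the
    terms with [diff s k x] vanish by the bound on [k].  This is a one-sided
    functional identity in the increments, so that all differences of order
    [e] of [k] vanish. *)
Lemma degree_lt_divX (t : D) e k : transcendental t ->
  degree_lt e.+1 k -> degree_lt e.+1 (fun x => x * k x) -> degree_lt e k.
Proof.
move=> trt Hk Hxk s sz x.
apply: (@one_sided_functional_identity t trt e 0 (fun i j s => diff s k x) _ 0%N 0%N) => // {}s {}sz.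
rewrite -[RHS](Hxk s sz x) diff_mulX Hk // mulr0 add0r sz.
by apply: eq_bigr => j _; rewrite big_ord1 mul1r addr0.
Qed.

Lemma degree_lt_divXn (t : D) e i k : transcendental t ->
  degree_lt e.+1 k -> degree_lt (i + e) (fun x => x ^+ i * k x) -> degree_lt e k.
Proof.
move=> trt Hk; elim: i => [|i IHi] Hi.
  by apply: degree_lt_eq Hi => x; rewrite mul1r.
apply/IHi/(degree_lt_divX trt).
  by rewrite -addnS; apply: degree_lt_mulXn.
by apply: degree_lt_eq Hi => x; rewrite exprS mulrA.
Qed.
End Degree.

(** * The center: transcendental elements, radicals, scaling *)

Section Center.
Context (D : unitRingType) (divD : division_ring D) (charD : 2%N \in [pchar D]).
Let unitD (x : D) : x != 0 -> x \is a GRing.unit. Proof. exact: divD. Qed.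

Lemma central0 : central (0 : D). Proof. by move=> x; rewrite mul0r mulr0. Qed.
Lemma central1 : central (1 : D). Proof. by move=> x; rewrite mul1r mulr1. Qed.
Lemma centralD (y z : D) : central y -> central z -> central (y + z).
Proof. by move=> cy cz x; rewrite mulrDl mulrDr cy cz. Qed.
Lemma centralM (y z : D) : central y -> central z -> central (y * z).
Proof. by move=> cy cz x; rewrite -mulrA cz !mulrA cy. Qed.
Lemma centralX (z : D) i : central z -> central (z ^+ i).
Proof.
by move=> cz; elim: i => [|i IHi]; [apply: central1 | rewrite exprS; apply: centralM].
Qed.
Lemma centralV (z : D) : central z -> central (z^-1).
Proof. by move=> cz x; apply/commr_sym/commrV/commr_sym. Qed.

(** Adjoin the [y i] one after the other to the prime field. *)
Lemma central_torsion_finite_subring (N : nat) (y : nat -> D) :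
  (forall z : D, central z -> z != 0 -> torsion z) -> (forall i, central (y i)) ->
  exists S : seq D, [/\ subring_closed (mem S), {in S, forall s, central s}
    & forall i, (i < N)%N -> y i \in S].
Proof.
move=> tors cy; elim: N => [|N [S [ringS cS yS]]].
  exists [:: 0; 1]; split=> //; first exact: prime_subring.
  by move=> s; rewrite !inE => /pred2P[]->; [apply: central0 | apply: central1].
have [yN0|yN0] := eqVneq (y N) 0.
  exists S; split=> // i; rewrite ltnS leq_eqVlt => /predU1P[->|/yS//].
  by case: ringS => S1 SB _; rewrite yN0 -(subrr 1) SB.
have [m m0 ym] := tors _ (cy N) yN0.
have [S1 SB SM] := ringS.
have [|||S' [ringS' SS' yS' S'P]] :=
    @finite_subring_adjoin D divD S (y N) m (fun i => (i == 0)%N%:R) ringS yN0 m0.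
- by move=> s sS; rewrite cy mulrK ?unitD.
- by move=> i; case: (i == 0)%N; rewrite /= ?mulr0n ?mulr1n // -(subrr 1) SB.
- case: m m0 ym => // m _ ->.
  by rewrite big_ord_recl mulr1 big1 ?addr0 // => i _; rewrite mul0r.
exists S'; split=> // [s /S'P[c cSi ->]|i].
  elim/big_ind: _ => [|u v|i _]; [exact: central0 | exact: centralD |].
  by apply: centralM; [apply/cS/cSi | apply: centralX].
by rewrite ltnS leq_eqVlt => /predU1P[->//|/yS/SS'].
Qed.

(** A nontorsion [t] exists by Jacobson's theorem.  It is not algebraic over the
    center: the coefficients of a monic relation would lie in a finite central
    subring, to which [t] could be adjoined, and [t] would be torsion. *)
Lemma transcendental_exists :
  (forall z : D, central z -> z != 0 -> torsion z) ->
  ~ (forall x y : D, x * y = y * x) -> exists t : D, transcendental t.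
Proof.
move=> tors ncD; apply: NNPP => notr; apply: ncD.
apply: (all_torsion_commutative divD charD) => t t0; apply: NNPP => ntt.
apply: notr; exists t => N z cz; elim: N => // N IHN.
have [zN0|zN0] := eqVneq (z N) 0.
  rewrite big_ord_recr /= zN0 mul0r addr0 => /IHN IH i.
  by rewrite ltnS leq_eqVlt => /predU1P[->|/IH].
case: N IHN zN0 => [_ zN0|N _ zN0 sum0].
  by rewrite big_ord1 mulr1 => z0; rewrite z0 eqxx in zN0.
case: ntt; pose y i := if (i < N.+1)%N then - ((z N.+1)^-1 * z i) else 0.
have cy i : central (y i).
  rewrite /y; case: ifP => _; last exact: central0.
  by rewrite -mulNr -[- _]mulN1r; do 2?[apply: centralM => //];
     [rewrite (opp2 charD); apply: central1 | apply: centralV].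
have [S [ringS cS yS]] := central_torsion_finite_subring N.+1 tors cy.
have [|||S' [ringS' _ tS' _]] := @finite_subring_adjoin D divD S t N.+1 y ringS t0 isT.
- by move=> s sS; rewrite -(cS s sS) mulrK ?unitD.
- move=> i; case: (ltnP i N.+1) => [/yS//|leNi].
  by have [S1 SB _] := ringS; rewrite /y ltnNge leNi -(subrr 1) SB.
- apply: (mulrI (unitD zN0)); move/eqP: sum0.
  rewrite big_ord_recr /= addrC addr_eq0 => /eqP ->; rewrite mulr_sumr -sumrN.
  apply: eq_bigr => i _; rewrite /y ltn_ord mulNr mulrN !mulrA.
  by rewrite divrr ?mul1r ?unitD.
exact: (finite_subring_torsion divD ringS' tS' t0).
Qed.

Lemma expr2n_addC (x y : D) k : x * y = y * x ->
  (x + y) ^+ (2 ^ k) = x ^+ (2 ^ k) + y ^+ (2 ^ k).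
Proof.
move=> cxy; elim: k => [|k IHk]; first by rewrite !expr1.
rewrite expnS mulnC !exprM IHk !expr2 mulrDl !mulrDr.
have -> : x ^+ (2 ^ k) * y ^+ (2 ^ k) = y ^+ (2 ^ k) * x ^+ (2 ^ k).
  exact/commrX/commr_sym/commrX/commr_sym.
by cancel2 D charD.
Qed.

(** Conjugation by [a] maps [y] to [y + 1], hence [y ^+ 2 ^ k] to
    [y ^+ 2 ^ k + 1]. *)
Lemma radical_shift (a y : D) k :
  a != 0 -> a * y = y * a + a -> ~ central (y ^+ (2 ^ k)).
Proof.
move=> a0 ay cy.
have ayi i : a * y ^+ i = (y + 1) ^+ i * a.
  elim: i => [|i IHi]; first by rewrite mulr1 mul1r.
  have e : y * a + a = (y + 1) * a by rewrite mulrDl mul1r.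
  by rewrite exprSr mulrA IHi -mulrA ay e mulrA -exprSr.
have := ayi (2 ^ k)%N; rewrite -cy expr2n_addC ?mul1r ?mulr1 // mulrDl expr1n mul1r.
by move/eqP; rewrite -subr_eq0 opprD addNKr oppr_eq0 (negPf a0).
Qed.

(** Some power [a] of [b] is noncentral with a central square.  For [x] not
    commuting with [a], the element [w := a * x + x * a] commutes with [a], so
    [y := x * w^-1 * a] satisfies [a * y = y * a + a]; so does [y + b], as [a]
    commutes with [b]. *)
Lemma radical_escape (b : D) k : central (b ^+ (2 ^ k)) -> ~ central b ->
  exists y, ~ central (y ^+ (2 ^ k)) /\ ~ central ((y + b) ^+ (2 ^ k)).
Proof.
move=> cbk ncb.
have [i nca ca2] : exists2 i, ~ central (b ^+ (2 ^ i)) & central (b ^+ (2 ^ i.+1)).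
  elim: k cbk => [|k IHk cbk]; first by rewrite expr1.
  by have [/IHk//|nc] := classic (central (b ^+ (2 ^ k))); exists k.
move: nca ca2; rewrite expnS mulnC exprM expr2.
have ab : b ^+ (2 ^ i) * b = b * b ^+ (2 ^ i) by rewrite -exprSr exprS.
set a := b ^+ _ in ab * => nca ca2.
have [x nax] := not_all_ex_not _ _ nca.
pose w := a * x + x * a.
have w0 : w != 0 by apply/eqP => /(eq_add2 charD).
have a0 : a != 0 by apply/eqP => a0; apply: nca; rewrite a0; apply: central0.
have aw : a * w = w * a.
  by rewrite mulrDl mulrDr !mulrA [RHS]addrC; congr (_ + _); rewrite ca2 mulrA.
have ay : a * (x * w^-1 * a) = x * w^-1 * a * a + a.
  have -> : x * w^-1 * a * a = x * a * w^-1 * a.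
    by rewrite -!mulrA; congr (x * _); rewrite !mulrA; congr (_ * _); apply/commr_sym/commrV.
  apply: (eq_add2 charD); rewrite addrA !mulrA -!mulrDl -/w divrr ?unitD //.
  by rewrite mul1r (add2 charD).
exists (x * w^-1 * a); split; apply: radical_shift a0 _ => //.
by rewrite mulrDr mulrDl ay ab; cancel2 D charD.
Qed.

(** An easy case of Kaplansky's theorem on rings radical over their center. *)
Lemma radical_commutative k : (forall x : D, central (x ^+ (2 ^ k))) ->
  forall x y : D, x * y = y * x.
Proof.
move=> rad x; apply: NNPP => ncx.
by have [y [+ _]] := radical_escape (rad x) ncx; apply.
Qed.

(** A Vandermonde argument: the powers of [z] are pairwise distinct, and
    combining the equations for [j] and [j.+1] removes the last coefficient. *)
Lemma scaling_separates_coefs (z : D) : z != 0 -> ~ torsion z ->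
  forall N (v : nat -> D), (forall j, \sum_(i < N) v i * z ^+ (i * j) = 0) ->
  forall i, (i < N)%N -> v i = 0.
Proof.
move=> z0 ntz; have Uz := unitD z0.
have zinj i j : (i < j)%N -> z ^+ i != z ^+ j.
  move=> ltij; apply/eqP => zij; apply: ntz; exists (j - i)%N; first by rewrite subn_gt0.
  by apply: (mulIr (unitrX i Uz)); rewrite -exprD subnK ?mul1r // ltnW.
elim=> // N IHN v Hv.
have v0 i : (i < N)%N -> v i = 0.
  move=> ltiN; have /(division_mulf_eq0 divD)[//|/eqP] : v i * (z ^+ i - z ^+ N) = 0.
    apply: (IHN (fun i => v i * (z ^+ i - z ^+ N))) => // j.
    transitivity (\sum_(i < N.+1) v i * z ^+ (i * j.+1) - (\sum_(i < N.+1) v i * z ^+ (i * j)) * z ^+ N).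
      rewrite !big_ord_recr /= mulrDl opprD addrACA.
      have -> : v N * z ^+ (N * j.+1) - v N * z ^+ (N * j) * z ^+ N = 0.
        by rewrite mulnSr exprD mulrA subrr.
      rewrite addr0 mulr_suml -sumrB; apply: eq_bigr => k _.
      by rewrite mulrBr mulrBl -!mulrA -!exprD -mulnS [(N + _)%N]addnC.
    by rewrite !Hv mul0r subrr.
  by rewrite subr_eq0 (negPf (zinj _ _ ltiN)).
move=> i; rewrite ltnS leq_eqVlt => /predU1P[->|/v0//].
have := Hv 0%N; rewrite big_ord_recr /= muln0 mulr1 big1 ?add0r // => k _.
by rewrite v0 // mul0r.
Qed.

(** The sum of all words of length [N] in [x] and [y] with [i] letters [y]. *)
Fixpoint word_sum (x y : D) (N i : nat) : D :=
  match N, i with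
  | 0, 0 => 1
  | 0, _.+1 => 0
  | N'.+1, 0 => x * word_sum x y N' 0
  | N'.+1, i'.+1 => x * word_sum x y N' i + y * word_sum x y N' i'
  end.

Lemma word_sum0 x y N : word_sum x y N 0 = x ^+ N.
Proof. by elim: N => //= N ->; rewrite exprS. Qed.

Lemma word_sum_oversize x y N i : (N < i)%N -> word_sum x y N i = 0.
Proof.
elim: N i => [|N IHN] [|i] //= ltNi.
by rewrite !IHN ?mulr0 ?addr0 // ltnW.
Qed.

Lemma expr_add_central (x y c : D) N : central c ->
  (x + c * y) ^+ N = \sum_(i < N.+1) word_sum x y N i * c ^+ i.
Proof.
move=> cc; elim: N => [|N IHN]; first by rewrite big_ord1 mulr1.
rewrite exprS IHN mulrDl [RHS]big_ord_recl mulr1 /=.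
have -> : x * (\sum_(i < N.+1) word_sum x y N i * c ^+ i) =
    x * word_sum x y N 0 + \sum_(i < N.+1) x * word_sum x y N i.+1 * c ^+ i.+1.
  rewrite big_ord_recl mulr1 mulrDr; congr (_ + _).
  rewrite [RHS]big_ord_recr /= word_sum_oversize // mulr0 mul0r addr0 mulr_sumr.
  by apply: eq_bigr => i _; rewrite mulrA.
rewrite -addrA mulr_sumr -big_split; congr (_ + _); apply: eq_bigr => i _ /=.
rewrite add0n mulrDl; congr (_ + _).
by rewrite exprS !mulrA; congr (_ * _); rewrite -mulrA cc.
Qed.

(** The sum of the [x ^+ j * y * x ^+ (N - 1 - j)] telescopes under the commutator
    with [x]. *)
Lemma word_sum1_commutator x y N :
  x * word_sum x y N 1 + word_sum x y N 1 * x = x ^+ N * y + y * x ^+ N.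
Proof.
elim: N => [|N IHN]; first by rewrite /= !mulr0 mul0r mul1r mulr1 addr0 (add2 charD).
rewrite /= word_sum0 mulrDr mulrDl.
transitivity (x * (x * word_sum x y N 1 + word_sum x y N 1 * x) + (x * (y * x ^+ N) + y * x ^+ N * x)).
  by rewrite mulrDr !mulrA; cancel2 D charD.
by rewrite IHN mulrDr !mulrA -exprS -[y * _ * x]mulrA -exprSr; cancel2 D charD.
Qed.

Lemma word_sum1_scale_r x y c N : central c -> word_sum x (c * y) N 1 = c * word_sum x y N 1.
Proof.
move=> cc; elim: N => [|N IHN] /=; first by rewrite mulr0.
by rewrite IHN !word_sum0 mulrDr !mulrA -[x * c]cc.
Qed.

Lemma word_sum1_scale_l x y c N : central c ->
  word_sum (c * x) y N.+1 1 = c ^+ N * word_sum x y N.+1 1.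
Proof.
move=> cc; elim: N => [|N IHN]; first by rewrite /= !mulr0 !add0r !mul1r.
have -> : word_sum (c * x) y N.+2 1 = c * x * word_sum (c * x) y N.+1 1 + y * (c * x) ^+ N.+1.
  by rewrite -(word_sum0 _ y).
have -> : word_sum x y N.+2 1 = x * word_sum x y N.+1 1 + y * x ^+ N.+1 by rewrite -(word_sum0 _ y).
rewrite IHN exprMn_comm; last exact: cc.
rewrite [RHS]mulrDr; set w := word_sum x y N.+1 1.
have -> : c * x * (c ^+ N * w) = c ^+ N.+1 * (x * w).
  by rewrite exprS -!mulrA; congr (c * _); rewrite !mulrA centralX.
have -> // : y * (c ^+ N.+1 * x ^+ N.+1) = c ^+ N.+1 * (y * x ^+ N.+1).
by rewrite !mulrA centralX.
Qed.

End Center.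

(** * Binomial coefficients modulo 2 *)

(** [2 ^ k] divides [j * 'C(2 ^ k, j)], but not [j]. *)
Lemma even_bin_pow2 k j : (0 < j < 2 ^ k)%N -> ~~ odd 'C(2 ^ k, j).
Proof.
case/andP=> j0 ltj; apply/negP => oddC.
have : (2 ^ k %| j * 'C(2 ^ k, j))%N.
  by case: j j0 {ltj oddC} => // j _; rewrite -mul_bin_diag dvdn_mulr.
rewrite Gauss_dvdl; last by rewrite coprimeXl ?coprime2n.
by move/(dvdn_leq j0); rewrite leqNgt ltj.
Qed.

(** Take for [2 ^ k] the largest power of 2 that is at most [n]. *)
Lemma power_or_odd_bin n : (0 < n)%N ->
  (exists k, n = 2 ^ k)%N \/
  exists k, [/\ (0 < k)%N, (2 ^ k < n)%N & odd 'C(n, 2 ^ k)].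
Proof.
move=> n0; have /andP[len ltn] := trunc_log_bounds (isT : (1 < 2)%N) n0.
move: (trunc_log 2 n) len ltn => k len ltn.
move: len; rewrite leq_eqVlt => /predU1P[<-|ltkn]; first by left; exists k.
right; exists k; split=> //.
  by case: k ltkn ltn => //; rewrite ltnNge => /negP.
rewrite -(subnKC (ltnW ltkn)) -binomial.Vandermonde big_ord_recr /= subnn bin0 muln1 binn oddD.
have q0 : (0 < 2 ^ k)%N by rewrite expn_gt0.
rewrite expnS in ltn.
case: (2 ^ k)%N q0 (@even_bin_pow2 k) ltkn ltn => // q _ evenC ltqn ltn.
rewrite big_ord_recl /= subn0 (@bin_small (n - q.+1)); last first.
  by rewrite ltn_subLR ?(ltnW ltqn) // addnn -mul2n.
rewrite muln0 add0n; suff /negPf -> : ~~ odd (\sum_(i < q) 'C(q.+1, bump 0 i) * 'C(n - q.+1, q.+1 - bump 0 i)) by [].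
elim/big_ind: _ => // [u v|i _]; first by rewrite oddD => /negPf-> /negPf->.
by rewrite oddM negb_and evenC //= ltnS ltn_ord.
Qed.

(** * The defect polynomial *)

Section Defect.
Context (D : unitRingType) (divD : division_ring D) (charD : 2%N \in [pchar D]).
Let unitD (x : D) : x != 0 -> x \is a GRing.unit. Proof. exact: divD. Qed.

Definition defect (n : nat) (x : D) : D := (1 + x) ^+ n + x ^+ n + 1.

Definition defect_coef (n i : nat) : nat := if (0 < i)%N then 'C(n, i) else 0.

Lemma natr_odd (m : nat) : m%:R = (odd m)%:R :> D.
Proof.
by rewrite -{1}[m]odd_double_half natrD -muln2 natrM (pcharf0 charD) mulr0 addr0.
Qed.

Lemma defectE n x : (0 < n)%N ->
  defect n x = \sum_(i < n) (defect_coef n i)%:R * x ^+ i.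
Proof.
case: n => // n _; rewrite /defect exprDn_comm; last by rewrite /GRing.comm mul1r mulr1.
rewrite big_ord_recr big_ord_recl /= !expr1n !mul1r bin0 binn expr0 !mulr1n.
rewrite [RHS]big_ord_recl /= mul0r add0r.
under eq_bigr do rewrite expr1n mul1r -mulr_natl.
by move: (\sum_(i < n) _) => w; cancel2 D charD.
Qed.

Lemma defect_pow2 k x : defect (2 ^ k) x = 0.
Proof.
rewrite /defect (expr2n_addC charD); last by rewrite mul1r mulr1.
by rewrite expr1n; cancel2 D charD.
Qed.

Lemma defect0 n : (0 < n)%N -> defect n 0 = 0.
Proof. by case: n => // n _; rewrite /defect addr0 expr1n expr0n /= addr0 (add2 charD). Qed.

Lemma defect1 n : (0 < n)%N -> defect n 1 = 0.
Proof.
by case: n => // n _; rewrite /defect (add2 charD) expr1n expr0n /= add0r (add2 charD).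
Qed.

(** The degree of the defect polynomial is the largest [d < n] such that
    ['C(n, d)] is odd. *)
Lemma defect_leading n i0 : (1 < i0 < n)%N -> odd 'C(n, i0) ->
  exists2 d, (1 < d)%N & forall x,
    defect n x = x ^+ d + \sum_(i < d) (defect_coef n i)%:R * x ^+ i.
Proof.
case/andP=> lt1i ltin oddC.
have n0 : (0 < n)%N by apply: leq_ltn_trans ltin.
have ex : exists i, (i < n)%N && odd (defect_coef n i).
  by exists i0; rewrite ltin /defect_coef (ltnW lt1i).
have bound i : (i < n)%N && odd (defect_coef n i) -> (i <= n)%N by case/andP=> /ltnW.
case: (ex_maxnP ex bound) => d /andP[ltdn oddd] maxd.
exists d; first by apply/(leq_trans lt1i)/maxd; rewrite ltin /defect_coef (ltnW lt1i).
move=> x; rewrite defectE // (big_ord_widen_cond n xpredT (fun i => (defect_coef n i)%:R * x ^+ i) (ltnW ltdn)).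
rewrite (bigID (fun i : 'I_n => (i < d)%N)) /= addrC; congr (_ + _).
rewrite (bigD1 (Ordinal ltdn)) /= ?ltnn // natr_odd oddd mul1r big1 ?addr0 // => i.
rewrite -leqNgt => /andP[ledi nei]; rewrite natr_odd; case: (boolP (odd _)) => [oddi|_].
  have := maxd i; rewrite ltn_ord oddi => /(_ isT) leid.
  by case/negP: nei; apply/eqP/val_inj/anti_leq; rewrite leid ledi.
by rewrite mul0r.
Qed.

Lemma additive_separation (z : D) (N : nat) (a : nat -> D) (h : D -> D) :
  central z -> z != 0 -> ~ torsion z ->
  (forall x, h x = \sum_(i < N) a i * x ^+ i) -> {morph h : x y / x + y} ->
  forall i x y, (i < N)%N -> a i * (x + y) ^+ i = a i * (x ^+ i + y ^+ i).
Proof.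
move=> cz z0 ntz hE hD i x y ltiN; apply/eqP; rewrite -subr_eq0; apply/eqP.
apply: (scaling_separates_coefs divD z0 ntz
  (v := fun i => a i * (x + y) ^+ i - a i * (x ^+ i + y ^+ i)) _ ltiN) => j.
have scale u : h (z ^+ j * u) = \sum_(i < N) a i * u ^+ i * z ^+ (i * j).
  rewrite hE; apply: eq_bigr => k _; rewrite exprMn_comm; last exact: centralX.
  by rewrite -!mulrA; congr (_ * _); rewrite -exprM mulnC centralX.
have := hD (z ^+ j * x) (z ^+ j * y); rewrite -mulrDr !scale -big_split => /eqP.
rewrite -subr_eq0 -sumrB => /eqP e; rewrite -[RHS]e; apply: eq_bigr => k _ /=.
by rewrite mulrBl mulrDr mulrDl.
Qed.

(** The form used for a power of [x + z ^+ j * y], whose extreme terms are the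
    powers of [x] and [y]. *)
Lemma scaling_separates_middle (z : D) (N : nat) (a : nat -> D) (s t : D) :
  z != 0 -> ~ torsion z ->
  (forall j, \sum_(i < N.+1) a i * z ^+ (i * j) = s + t * z ^+ (N * j)) ->
  forall i, (0 < i < N)%N -> a i = 0.
Proof.
move=> z0 ntz Ha i /andP[i0 ltiN]; have N0 : (0 < N)%N by apply: ltn_trans ltiN.
pose v k := a k - (if k == 0%N then s else if k == N then t else 0).
have <- : v i = a i by rewrite /v (gtn_eqF i0) (ltn_eqF ltiN) subr0.
apply: (scaling_separates_coefs divD z0 ntz (N := N.+1)) => [j|]; last by rewrite ltnS ltnW.
under eq_bigr do rewrite mulrBl.
rewrite sumrB Ha; case: N N0 {Ha ltiN v} => // N _.
rewrite big_ord_recl big_ord_recr /= eqxx mul0n mulr1 big1 ?add0r ?subrr // => k _.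
by rewrite eqSS ltn_eqF ?mul0r.
Qed.

(** Scaling [y] in [(x + y) ^+ (2 ^ k)] isolates the part linear in [y], which
    has to vanish; its commutator with [x] is that of [x ^+ (2 ^ k)] with
    [y]. *)
Lemma additive_power_commutative (z : D) k : central z -> z != 0 -> ~ torsion z ->
  (0 < k)%N -> (forall x y : D, (x + y) ^+ (2 ^ k) = x ^+ (2 ^ k) + y ^+ (2 ^ k)) ->
  forall x y : D, x * y = y * x.
Proof.
move=> cz z0 ntz k0 powD; apply: (radical_commutative divD charD (k := k)) => x y.
have q1 : (1 < 2 ^ k)%N by rewrite -{1}(expn0 2) ltn_exp2l.
set q := (2 ^ k)%N in powD q1 *.
have w0 : word_sum x y q 1 = 0.
  apply: (scaling_separates_middle (N := q) (s := x ^+ q) (t := y ^+ q) z0 ntz) => // j.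
  under eq_bigr do rewrite mulnC exprM.
  rewrite -(expr_add_central x y q (centralX j cz)) powD; congr (_ + _).
  by rewrite exprMn_comm -?exprM; [rewrite mulnC centralX | apply: centralX].
by apply: (eq_add2 charD); rewrite -(word_sum1_commutator charD) w0 mulr0 mul0r addr0.
Qed.
End Defect.

(** * The consequences of Hua's identity *)

Section Identity.
Context (D : unitRingType) (divD : division_ring D) (charD : 2%N \in [pchar D]).
Context (ncD : ~ (forall x y : D, x * y = y * x)).
Let unitD (x : D) : x != 0 -> x \is a GRing.unit. Proof. exact: divD. Qed.

Definition inverse_identity (n : nat) (f g : D -> D) :=
  forall x, x != 0 -> f x = x ^+ n * g x^-1.

Lemma inverse_identity_sym n f g : inverse_identity n f g -> inverse_identity n g f.
Proof.
move=> fg x x0; have Ux := unitD x0.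
by rewrite fg ?invr_eq0 // invrK mulrA exprVn mulrV ?unitrX // mul1r.
Qed.

Lemma inverse_identity_at1 n f g : inverse_identity n f g -> f 1 = g 1.
Proof. by move=> fg; rewrite fg ?oner_eq0 // expr1n invr1 mul1r. Qed.

Lemma additive_at0 (f : D -> D) : {morph f : x y / x + y} -> f 0 = 0.
Proof. by move=> fD; apply: (addrI (f 0)); rewrite -fD !addr0. Qed.

Section Positive.
Context (n : nat) (n0 : (0 < n)%N) (f g : D -> D).
Context (fD : {morph f : x y / x + y}) (gD : {morph g : x y / x + y}).
Context (fg : inverse_identity n f g).

Let f0 : f 0 = 0. Proof. exact: additive_at0. Qed.
Let g0 : g 0 = 0. Proof. exact: additive_at0. Qed.

(** Evaluate [f] at [u := a * s], where [s := 1 + a * b]: the point is that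
    [u^-1 = a^-1 + (b^-1 + a)^-1], so that [fg] and additivity express [f u]
    by [f a] and [g b], while [u = a + a * a * b]. *)
Lemma hua_commuting a b : a * b = b * a ->
  f (a * a * b) = defect n (a * b) * f a + a ^+ n * g b.
Proof.
move=> cab.
have [->|a0] := eqVneq a 0; first by rewrite !mul0r f0 mulr0 expr0n -[n == 0]negbK -lt0n n0 mul0r addr0.
have [->|b0] := eqVneq b 0; first by rewrite !mulr0 defect0 // f0 g0 mul0r mulr0 addr0.
have Ua := unitD a0; have Ub := unitD b0.
have [ab1|ab1] := eqVneq (a * b) 1.
  have -> : b = a^-1 by apply: (mulrI Ua); rewrite ab1 divrr.
  by rewrite mulrV // defect1 // mul0r add0r -fg // mulrK.
pose s := 1 + a * b.
have s0 : s != 0 by apply: contraNneq ab1 => /(eq_add2 charD) <-.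
have Us := unitD s0.
have cas : a * s = s * a.
  by rewrite /s mulrDl mulrDr mul1r mulr1 -mulrA -cab.
have cbs : b * s = s * b.
  by rewrite /s mulrDl mulrDr mul1r mulr1 mulrA -cab.
pose v := b^-1 + a.
have vE : v = b^-1 * s by rewrite /s mulrDr mulr1 cab mulKr.
have v0 : v != 0 by rewrite vE; apply/eqP => /(division_mulf_eq0 divD)[] /eqP; rewrite ?invr_eq0 ?(negPf b0) ?(negPf s0).
have Uv := unitD v0.
have vV : v^-1 = s^-1 * b by rewrite vE invrM ?unitrV // invrK.
have u0 : a * s != 0 by apply/eqP => /(division_mulf_eq0 divD)[] /eqP; rewrite ?(negPf a0) ?(negPf s0).
have uV : (a * s)^-1 = a^-1 + v^-1.
  apply: (mulrI Us); rewrite invrM // mulrDr vV !mulVKr //.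
  by rewrite /s mulrDl mul1r cab mulrK // -addrA (add2 charD) addr0.
have := fg u0; rewrite uV gD.
have -> : g a^-1 = a^-1 ^+ n * f a by rewrite (inverse_identity_sym fg) ?invr_eq0 // invrK.
have -> : g v^-1 = v^-1 ^+ n * (b^-1 ^+ n * g b + f a).
  rewrite (inverse_identity_sym fg) ?invr_eq0 // invrK /v fD; congr (_ * (_ + _)).
  by rewrite fg ?invr_eq0 // invrK.
have -> : f (a * s) = f a + f (a * a * b) by rewrite /s mulrDr mulr1 fD mulrA.
rewrite mulrDr.
have -> : (a * s) ^+ n * (a^-1 ^+ n * f a) = s ^+ n * f a.
  by rewrite cas exprMn_comm // mulrA exprVn mulrK // unitrX.
have -> : (a * s) ^+ n * (v^-1 ^+ n * (b^-1 ^+ n * g b + f a)) = (a * b) ^+ n * (b^-1 ^+ n * g b + f a).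
  rewrite mulrA -exprMn_comm; first by rewrite vV mulrA mulrK.
  rewrite /GRing.comm vV.
  have csab : s^-1 * b * (a * s) = a * b by rewrite cas !mulrA -[s^-1 * b * s]mulrA cbs mulrA mulVr // mul1r cab.
  by rewrite csab mulrA mulrK.
have -> : (a * b) ^+ n * (b^-1 ^+ n * g b + f a) = a ^+ n * g b + (a * b) ^+ n * f a.
  by rewrite mulrDr; congr (_ + _); rewrite exprMn_comm // mulrA exprVn mulrK ?unitrX.
move=> e; have -> : f (a * a * b) = f a + (f a + f (a * a * b)) by rewrite (add2K charD).
rewrite e /defect -/s !mulrDl mul1r; cancel2 D charD.
Qed.

Lemma identity_square x : f (x * x) = defect n x * f x + x ^+ n * f 1.
Proof.
have := @hua_commuting x 1; rewrite mulr1 mul1r mulr1 => -> //.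
by rewrite (inverse_identity_at1 fg).
Qed.

Lemma identity_sum x : f x + g x = defect n x * f 1.
Proof.
have := @hua_commuting 1 x; rewrite !mul1r mulr1 expr1n mul1r => -> //.
by rewrite -addrA (add2 charD) addr0.
Qed.
End Positive.
End Identity.

(** * Vanishing for positive exponents *)

Section Vanishing.
Context (D : unitRingType) (divD : division_ring D) (charD : 2%N \in [pchar D]).
Context (ncD : ~ (forall x y : D, x * y = y * x)).
Context (n : nat) (n0 : (0 < n)%N) (f g : D -> D).
Context (fD : {morph f : x y / x + y}) (gD : {morph g : x y / x + y}).
Context (fg : inverse_identity n f g).

Let unitD (x : D) : x != 0 -> x \is a GRing.unit. Proof. exact: divD. Qed.
Let f0 : f 0 = 0. Proof. exact: additive_at0. Qed.
Let square := identity_square divD charD n0 fD gD fg.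
Let sum_fg := identity_sum divD charD n0 fD gD fg.

Lemma square_commutator x y :
  f (x * y + y * x) = f ((x + y) * (x + y)) + f (x * x) + f (y * y).
Proof. by rewrite mulrDl !mulrDr !fD; cancel2 D charD. Qed.

(** [f] vanishes on squares, hence on commutators, hence is constant on
    conjugacy classes; this makes [z ^+ n] central when [f z != 0].  By
    [radical_escape], an element [b] outside the kernel is then central: if
    not, [y] and [y + b] would both lie in the kernel.  Since the complement
    of a proper subgroup generates, everything would be central. *)
Lemma vanish_pow2 k : n = (2 ^ k)%N -> f 1 = 0 -> forall x, f x = 0.
Proof.
move=> nE c0.
have gf x : g x = f x.
  by apply: (eq_add2 charD); rewrite addrC sum_fg c0 mulr0.
have sq0 x : f (x * x) = 0 by rewrite square c0 nE (defect_pow2 charD) mul0r mulr0 addr0.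
have tr x y : f (x * y) = f (y * x).
  by apply: (eq_add2 charD); rewrite -fD square_commutator !sq0 !addr0.
have npow z : f z != 0 -> central (z ^+ n).
  move=> fz x; have [->|x0] := eqVneq x 0; first by rewrite mul0r mulr0.
  have Ux := unitD x0; have z0 : z != 0 by apply: contraNneq fz => ->; rewrite f0.
  have conj w : f (x * w * x^-1) = f w by rewrite tr mulrA mulVr // mul1r.
  have cj0 : x * z * x^-1 != 0 by apply: contraNneq fz => e; rewrite -conj e f0.
  have cjV : (x * z * x^-1)^-1 = x * z^-1 * x^-1.
    have Uz := unitD z0.
    have Uxz : x * z \is a GRing.unit by rewrite unitrMr.
    by rewrite (invrM Uxz (etrans (unitrV x) Ux)) invrK (invrM Ux Uz) mulrA.
  have cjX i : (x * z * x^-1) ^+ i = x * z ^+ i * x^-1.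
    elim: i => [|i IHi]; first by rewrite mulr1 mulrV.
    by rewrite exprS IHi exprS !mulrA mulrVK.
  have := fg cj0; rewrite cjV cjX !gf !conj fg // gf.
  have fV : f z^-1 != 0 by apply: contraNneq fz => e; rewrite fg // gf e mulr0.
  move/(mulIr (unitD fV)) => /(congr1 (fun w => w * x)) ->.
  by rewrite mulrVK.
have central_out b : f b != 0 -> central b.
  move=> fb; apply: NNPP => ncb.
  have cbn : central (b ^+ (2 ^ k)) by rewrite -nE; apply: npow.
  have [y [ny nyb]] := radical_escape divD charD cbn ncb.
  have fy : f y = 0.
    by apply/eqP/negPn/negP => fy; apply: ny; rewrite -nE; apply: npow.
  by apply: nyb; rewrite -nE; apply: npow; rewrite fD fy add0r.
move=> b; apply/eqP/negPn/negP => fb; apply: ncD => x.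
have [/eqP fx|] := boolP (f x == 0); last exact: central_out.
have := centralD (central_out (x + b) _) (central_out b fb).
by rewrite fD fx add0r -addrA (add2 charD) addr0; apply.
Qed.

Lemma noncommuting_commutator : exists x y : D, x * y + y * x != 0.
Proof.
apply: NNPP => none; apply: ncD => x y; apply: (eq_add2 charD).
by apply/eqP/negPn/negP => nxy; apply: none; exists x, y.
Qed.

(** Here [f (x * x) = x * c] and [f] kills commutators.  The square of a
    commutator [w] is a sum of commutators in characteristic 2, so
    [w * c = 0]. *)
Lemma value_at1_exponent1 : n = 1%N -> f 1 = 0.
Proof.
move=> n1; have sq x : f (x * x) = x * f 1.
  by rewrite square n1 -[X in defect X]/(2 ^ 0)%N (defect_pow2 charD) mul0r add0r.
have tr x y : f (x * y) = f (y * x).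
  apply: (eq_add2 charD); rewrite -fD square_commutator !sq mulrDl.
  by cancel2 D charD.
have [x [y w0]] := noncommuting_commutator.
apply: (mulrI (unitD w0)); rewrite mulr0 -sq mulrDl !mulrDr !fD.
(* of the four words in [w * w], [x y x y] and [y x y x] are cyclic shifts of
   each other, and so are [x y y x] and [y x x y] of [x x y y] *)
rewrite (_ : x * y * (x * y) = x * (y * x * y)); last by rewrite !mulrA.
rewrite (_ : y * x * (y * x) = y * x * y * x); last by rewrite !mulrA.
rewrite (_ : x * y * (y * x) = x * y * y * x); last by rewrite !mulrA.
rewrite [f (x * (y * x * y))]tr [f (x * y * y * x)]tr.
rewrite (_ : x * (x * y * y) = x * x * y * y); last by rewrite !mulrA.
rewrite [f (x * x * y * y)]tr !mulrA.
by cancel2 D charD.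
Qed.

Section CentralScaling.
Context (z : D) (cz : central z) (z0 : z != 0) (ntz : ~ torsion z).

(** If [c != 0] then the defect polynomial is additive, and so is its
    homogeneous part [x ^+ (2 ^ k)]. *)
Lemma value_at1_scaling_defect k :
  (0 < k)%N -> (2 ^ k < n)%N -> odd 'C(n, 2 ^ k) -> f 1 = 0.
Proof.
move=> k0 ltkn oddC; apply/eqP/negPn/negP => c0; apply: ncD.
have dD : {morph @defect D n : x y / x + y}.
  by move=> x y; apply: (mulIr (unitD c0)); rewrite [RHS]mulrDl -!sum_fg fD gD addrACA.
apply: (additive_power_commutative divD charD cz z0 ntz k0) => x y.
have := additive_separation (a := fun i => (defect_coef n i)%:R) divD cz z0 ntz (fun u => defectE charD u n0) dD x y ltkn.
by rewrite /defect_coef expn_gt0 /= (natr_odd charD) oddC !mul1r.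
Qed.

(** Comparing [f (t * t * b)] with [f ((t + 1) * (t + 1) * b)] for a central
    [t], a power of [z] with nonzero defect, gives
    [defect n t * f b = h b * f t] for a polynomial [h] with central
    coefficients.  If [f t != 0] then [h] is additive; its coefficient of
    degree [2 ^ k] is [(t + 1) ^+ (2 ^ k) + t ^+ (2 ^ k) = 1]. *)
Lemma vanish_scaling_defect k :
  (0 < k)%N -> (2 ^ k < n)%N -> odd 'C(n, 2 ^ k) -> f 1 = 0 -> forall x, f x = 0.
Proof.
move=> k0 ltkn oddC c0; have lt0k : (0 < 2 ^ k)%N by rewrite expn_gt0.
have coef1 : (defect_coef n (2 ^ k))%:R = 1 :> D.
  by rewrite /defect_coef lt0k (natr_odd charD) oddC.
have gf x : g x = f x.
  by apply: (eq_add2 charD); rewrite addrC sum_fg c0 mulr0.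
have [j dj] : exists j, defect n (z ^+ j) != 0.
  apply: NNPP => none; have := oner_neq0 D; rewrite -coef1 => /eqP[].
  apply: (scaling_separates_coefs divD z0 ntz (N := n)
            (v := fun i => (defect_coef n i)%:R)) => // j.
  apply: (etrans _ (_ : defect n (z ^+ j) = 0)); last first.
    by apply/eqP/negPn/negP => dj; apply: none; exists j.
  by rewrite defectE //; apply: eq_bigr => i _; rewrite -exprM mulnC.
set t := z ^+ j in dj; have ct : central t by apply: centralX.
pose h b := defect n ((t + 1) * b) + defect n (t * b).
have hE b : defect n t * f b = h b * f t.
  have ct1 : central (t + 1) by apply: centralD => //; apply: central1.
  have := hua_commuting divD charD n0 fD gD fg (ct1 b).
  have := hua_commuting divD charD n0 fD gD fg (ct b).
  rewrite fD c0 addr0 gf => e1.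
  have -> : (t + 1) * (t + 1) * b = t * t * b + b.
    by rewrite !(mulrDl, mulrDr) !(mul1r, mulr1); cancel2 D charD.
  rewrite fD e1 => e2.
  have -> : defect n t * f b = (t + 1) ^+ n * f b + t ^+ n * f b + f b.
    by rewrite /defect 2!mulrDl mul1r [1 + t]addrC.
  have -> : h b * f t = defect n ((t + 1) * b) * f t + defect n (t * b) * f t.
    exact: mulrDl.
  have -> : defect n ((t + 1) * b) * f t =
      defect n (t * b) * f t + t ^+ n * f b + f b + (t + 1) ^+ n * f b.
    by rewrite e2; cancel2 D charD.
  by cancel2 D charD.
have [ft0|ft0] := eqVneq (f t) 0.
  move=> b; have := hE b; rewrite ft0 mulr0.
  by move/(division_mulf_eq0 divD) => [/eqP|//]; rewrite (negPf dj).
case: ncD; apply: (additive_power_commutative divD charD cz z0 ntz k0) => x y.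
have hD : {morph h : x y / x + y}.
  move=> u v; apply: (mulIr (unitD ft0)).
  by rewrite [RHS]mulrDl -!hE fD mulrDr.
pose a i := (defect_coef n i)%:R * ((t + 1) ^+ i + t ^+ i).
have hsum b : h b = \sum_(i < n) a i * b ^+ i.
  rewrite /h !defectE // -big_split; apply: eq_bigr => i _ /=.
  have ct1 : central (t + 1) by apply: centralD => //; apply: central1.
  rewrite !exprMn_comm; [|exact: ct | exact: ct1].
  by rewrite /a -mulrA mulrDl -mulrDr.
have := additive_separation (a := a) divD cz z0 ntz hsum hD x y ltkn.
have ct1 : t * 1 = 1 * t by rewrite mul1r mulr1.
rewrite /a coef1 mul1r (expr2n_addC charD k ct1) expr1n.
have -> : t ^+ (2 ^ k) + 1 + t ^+ (2 ^ k) = 1 by cancel2 D charD.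
by rewrite !mul1r.
Qed.

(** Since [f (x * x) = x ^+ n * c], the value of [f] at the commutator of [x]
    and [y] is [((x + y) ^+ n + x ^+ n + y ^+ n) * c].  The commutators of
    [z * x] with [y] and of [x] with [z * y] agree; on the parts of
    degree one in [z] this says that the component [word_sum x y n 1] is
    symmetric.  It is linear in [y] and of degree [n - 1] in [x], so for
    [n > 2] it vanishes, and [x ^+ n] is central. *)
Lemma value_at1_scaling_pow2 k : (1 < k)%N -> n = (2 ^ k)%N -> f 1 = 0.
Proof.
move=> k1 nE; have n2 : (2 < n)%N by rewrite nE (leq_trans _ (leq_pexp2l _ k1)).
apply/eqP/negPn/negP => c0; apply: ncD; apply: (radical_commutative divD charD (k := k)) => x y.
have sq u : f (u * u) = u ^+ n * f 1.
  by rewrite square nE (defect_pow2 charD) mul0r add0r.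
have bal (u v c : D) : central c ->
    (c * u + v) ^+ n + (c * u) ^+ n + v ^+ n = (u + c * v) ^+ n + u ^+ n + (c * v) ^+ n.
  move=> cc; apply: (mulIr (unitD c0)); rewrite !mulrDl -!sq -!square_commutator.
  by congr f; rewrite !mulrA (cc u) (cc v).
have wsym (u v : D) : word_sum u v n 1 = word_sum v u n 1.
  apply: (eq_add2 charD).
  apply: (scaling_separates_middle divD (N := n) (a := fun i => word_sum u v n i + word_sum v u n i)
    (s := u ^+ n + v ^+ n) (t := u ^+ n + v ^+ n) z0 ntz) => [j /=|]; last by rewrite (ltnW n2).
  have cj := centralX j cz; have := bal u v _ cj.
  rewrite [z ^+ j * u + v]addrC !(expr_add_central _ _ _ cj) !exprMn_comm; try exact: cj.
  move=> e; under [in LHS]eq_bigr do rewrite mulrDl mulnC exprM.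
  rewrite big_split /= [(n * j)%N]mulnC exprM mulrDl -!(centralX n cj).
  move: (\sum_(i < n.+1) _) (\sum_(i < n.+1) _) e => A B e.
  move/eqP: e; rewrite -subr_eq0 (opp2 charD) => /eqP e.
  apply: (eq_add2 charD); rewrite -[RHS]e {e}.
  move: (u ^+ n) (v ^+ n) (_ * u ^+ n) (_ * v ^+ n) => p q r s; cancel2 D charD.
have w0 : word_sum x y n 1 = 0.
  have scale : z * word_sum x y n 1 = z ^+ n.-1 * word_sum x y n 1.
    have nP : n = n.-1.+1 by rewrite prednK.
    have := wsym x (z * y); rewrite (word_sum1_scale_r x y n cz) => ->.
    by rewrite (wsym x y) nP (word_sum1_scale_l y x n.-1 cz).
  move: (word_sum x y n 1) scale => w; move/eqP; rewrite -subr_eq0 -mulrBl.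
  move/eqP/(division_mulf_eq0 divD) => [|//] /eqP; rewrite subr_eq0 => /eqP zn.
  case: ntz; exists n.-2; first by rewrite -subn2 subn_gt0.
  apply: (mulIr (unitD z0)); rewrite mul1r -exprSr [RHS]zn prednK //.
  by rewrite -subn1 subn_gt0 ltnW.
apply: (eq_add2 charD).
by rewrite -nE -(word_sum1_commutator charD) w0 mulr0 mul0r addr0.
Qed.
End CentralScaling.

Section Transcendental.
Context (t : D) (trt : transcendental t).

(** The leading term [x ^+ d * h x] has at most the degree of the whole product
    or of the lower terms, so it drops by one, and [h] with it. *)
Lemma defect_degree i0 e (h : D -> D) : (1 < i0 < n)%N -> odd 'C(n, i0) ->
  degree_lt e.+1 h -> degree_lt e.+2 (fun x => defect n x * h x) -> degree_lt e h.
Proof.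
move=> hi oddC He Hd; have [d d1 dE] := defect_leading charD hi oddC.
apply: (degree_lt_divXn divD charD (i := d) trt He).
apply: (degree_lt_eq (h := fun x => defect n x * h x +
    \sum_(i < d) (defect_coef n i)%:R * (x ^+ i * h x))) => [x|].
  rewrite dE mulrDl -addrA -[RHS]addr0; congr (_ + _).
  by rewrite mulr_suml -big_split big1 // => i _ /=; rewrite mulrA (add2 charD).
apply: degree_ltD; first by apply: (degree_ltW _ Hd); rewrite -add2n leq_add2r.
apply: degree_lt_sum => i _.
apply: (@degree_lt_natl D (d + e) _ (fun x => x ^+ i * h x)).
by apply: (degree_ltW _ (degree_lt_mulXn (i := i) charD He)); rewrite addnS -addSn leq_add2r.
Qed.

Lemma value_at1_transcendental_defect i0 : (1 < i0 < n)%N -> odd 'C(n, i0) -> f 1 = 0.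
Proof.
move=> hi oddC; apply: (@defect_degree i0 0 (fun=> f 1) hi oddC _ _ [::] erefl 0).
  exact: degree_lt_cst.
apply: (degree_lt_eq (h := fun x => f x + g x)) => [x|]; first exact: sum_fg.
by apply: degree_ltD; apply: degree_lt_additive.
Qed.

Lemma vanish_transcendental_defect i0 : (1 < i0 < n)%N -> odd 'C(n, i0) ->
  f 1 = 0 -> forall x, f x = 0.
Proof.
move=> hi oddC c0 x.
have : degree_lt 1 f.
  apply: (defect_degree hi oddC); first exact: degree_lt_additive.
  apply: (degree_lt_eq (h := fun x => f (x * x))) => [u|].
    by rewrite square c0 mulr0 addr0.
  exact: degree_lt_additive_square.
by move=> /(_ [:: x] erefl 0) /=; rewrite add0r f0 addr0.
Qed.

Lemma value_at1_transcendental_pow2 k : (1 < k)%N -> n = (2 ^ k)%N -> f 1 = 0.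
Proof.
move=> k1 nE; have n2 : (2 < n)%N by rewrite nE (leq_trans _ (leq_pexp2l _ k1)).
apply: (@degree_lt_divXn D divD charD t 0 n (fun=> f 1) trt _ _ [::] erefl 0).
  exact: degree_lt_cst.
rewrite addn0.
apply: (degree_lt_eq (h := fun x => f (x * x))) => [u|].
  by rewrite square nE (defect_pow2 charD) mul0r add0r.
by apply: (degree_ltW n2); apply: degree_lt_additive_square.
Qed.
End Transcendental.

Lemma scaling_or_transcendental :
  (exists z : D, [/\ central z, z != 0 & ~ torsion z]) \/ exists t : D, transcendental t.
Proof.
have [|none] := classic (exists z : D, [/\ central z, z != 0 & ~ torsion z]); [by left | right].
apply: (transcendental_exists divD charD) => // z cz z0.
by apply: NNPP => ntz; apply: none; exists z.
Qed.

Lemma vanish : f 1 = 0 -> forall x, f x = 0.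
Proof.
have [[k nE]|[k [k0 ltkn oddC]]] := power_or_odd_bin n0; first exact: vanish_pow2 nE.
have hi : (1 < 2 ^ k < n)%N by rewrite ltkn -{1}(expn0 2) ltn_exp2l ?k0.
have [[z [cz z0 ntz]]|[t trt]] := scaling_or_transcendental.
  exact: (vanish_scaling_defect cz z0 ntz k0).
exact: (vanish_transcendental_defect trt hi).
Qed.

Lemma value_at1 : n <> 2%N -> f 1 = 0.
Proof.
move=> n2; have [[k nE]|[k [k0 ltkn oddC]]] := power_or_odd_bin n0.
  have [k1|] := ltnP 1 k.
    have [[z [cz z0 ntz]]|[t trt]] := scaling_or_transcendental.
      exact: (value_at1_scaling_pow2 cz z0 ntz k1).
    exact: (value_at1_transcendental_pow2 trt k1).
  by case: k nE => [|[|k]] // nE _; apply: value_at1_exponent1.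
have hi : (1 < 2 ^ k < n)%N by rewrite ltkn -{1}(expn0 2) ltn_exp2l ?k0.
have [[z [cz z0 ntz]]|[t trt]] := scaling_or_transcendental.
  exact: (value_at1_scaling_defect cz z0 ntz k0).
exact: (value_at1_transcendental_defect trt hi).
Qed.
End Vanishing.

(** * The exponent zero *)

Section ExponentZero.
Context (D : unitRingType) (divD : division_ring D) (charD : 2%N \in [pchar D]).
Context (ncD : ~ (forall x y : D, x * y = y * x)) (f g : D -> D).
Context (fD : {morph f : x y / x + y}) (gD : {morph g : x y / x + y}).
Context (fg : inverse_identity 0 f g).

Let unitD (x : D) : x != 0 -> x \is a GRing.unit. Proof. exact: divD. Qed.
Let f0 : f 0 = 0. Proof. exact: additive_at0. Qed.

(** For [x := s * r] and [y := s * (r + 1)] one has [x + y = s] and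
    [x^-1 + y^-1 = (s * (r * (r + 1)))^-1]. *)
Lemma exponent0_absorb s r :
  s * r = r * s -> s != 0 -> r != 0 -> r != 1 -> f (s * (r * (r + 1))) = f s.
Proof.
move=> csr s0 r0 r1.
have r10 : r + 1 != 0 by apply: contraNneq r1 => /(eq_add2 charD) ->.
have Us := unitD s0; have Ur := unitD r0; have Ur1 := unitD r10.
have Usr : s * r \is a GRing.unit by rewrite unitrMr.
have Usr1 : s * (r + 1) \is a GRing.unit by rewrite unitrMr.
have Urr : r * (r + 1) \is a GRing.unit by rewrite unitrMr.
have nz (u : D) : u \is a GRing.unit -> u != 0.
  by apply: contraTneq => ->; rewrite unitr0.
have -> : f s = f (s * r) + f (s * (r + 1)).
  by rewrite -fD mulrDr mulr1 addrA (add2 charD) add0r.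
have Usrr : s * (r * (r + 1)) \is a GRing.unit by rewrite unitrMr.
rewrite !fg ?nz // !mul1r -gD; congr g.
have cr : r * (r + 1) = (r + 1) * r by rewrite mulrDl mulrDr mul1r mulr1.
apply: (mulIr Usrr); rewrite mulVr // mulrDl.
have e1 : s * (r * (r + 1)) = s * r * (r + 1) by rewrite mulrA.
have e2 : s * (r * (r + 1)) = s * (r + 1) * r by rewrite cr mulrA.
rewrite {1}e1 mulKr // e2 mulKr //.
by rewrite addrAC (add2 charD) add0r.
Qed.

(** Write [w = s * (r * (r + 1)) + s] and apply [exponent0_absorb]. *)
Lemma exponent0_vanish_at w r : w * r = r * w -> r != 0 -> r != 1 ->
  r * (r + 1) + 1 != 0 -> f w = 0.
Proof.
move=> cwr r0 r1 e0; have [->|w0] := eqVneq w 0; first exact: f0.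
set e := r * (r + 1) + 1 in e0.
have cre : r * e = e * r.
  by rewrite /e mulrDl !mulrDr !mulrDl !mulr1 !mul1r -!mulrA.
have s0 : w * e^-1 != 0.
  by apply/eqP => /(division_mulf_eq0 divD)[] /eqP; rewrite ?invr_eq0 (negPf w0, negPf e0).
have csr : w * e^-1 * r = r * (w * e^-1).
  have ceV : e^-1 * r = r * e^-1 by apply/commr_sym/commrV.
  by rewrite -mulrA ceV !mulrA cwr.
have wE : w = w * e^-1 * (r * (r + 1)) + w * e^-1.
  by rewrite -[X in _ = _ + X]mulr1 -mulrDr -/e mulrVK // unitD.
by rewrite wE fD exponent0_absorb // (add2 charD).
Qed.

(** By [exponent0_vanish_at] with [r := w], only elements of order 3 can escape
    the kernel.  If [w] does, so does [w + r] for every [r] that is not a root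
    of unity, whence [w * r + r * w = r * r + r].  This fails for one of
    [r := t] and [r := t * t]. *)
Lemma exponent0_vanish w : f w = 0.
Proof.
have [t [t0 ntt]] : exists t : D, t != 0 /\ ~ torsion t.
  apply: NNPP => none; apply: ncD; apply: (all_torsion_commutative divD charD) => t t0.
  by apply: NNPP => ntt; apply: none; exists t.
have ntn1 (r : D) : ~ torsion r -> r != 1.
  by move=> ntr; apply/eqP => r1; apply: ntr; exists 1%N; rewrite ?expr1.
have ntom (r : D) : ~ torsion r -> r * (r + 1) + 1 != 0.
  move=> ntr; apply/eqP => /(eq_add2 charD) om; apply: ntr; exists 3%N => //.
  have r2 : r * r = r + 1.
    by rewrite -om mulrDr mulr1 addrCA (add2 charD) addr0.
  by rewrite exprS expr2 r2.
have f1 : f 1 = 0 by apply: (@exponent0_vanish_at 1 t); rewrite ?mul1r ?mulr1 ?ntn1 ?ntom.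
have fself u : f u != 0 -> u * (u + 1) + 1 = 0.
  move=> fu; apply/eqP/negPn/negP => om; move/eqP: fu; apply.
  have [->|u0] := eqVneq u 0; first exact: f0.
  have [->|u1] := eqVneq u 1; first exact: f1.
  exact: (@exponent0_vanish_at u u).
apply/eqP/negPn/negP => fw.
have wr r : r != 0 -> ~ torsion r -> w * r + r * w = r * r + r.
  move=> r0 ntr; have fr : f r = 0 by apply: (@exponent0_vanish_at r r); rewrite ?ntn1 ?ntom.
  have e1 := fself w fw; have e2 : (w + r) * (w + r + 1) + 1 = 0.
    by apply: fself; rewrite fD fr addr0.
  apply: (eq_add2 charD); rewrite -[RHS](addr0 0) -{1}e1 -e2.
  by rewrite !(mulrDl, mulrDr) !mulr1; cancel2 D charD.
have tt0 : t * t != 0 by apply/eqP => /(division_mulf_eq0 divD)[] /eqP; rewrite (negPf t0).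
have nttt : ~ torsion (t * t).
  case=> m m0 tm; apply: ntt; exists (2 * m)%N; first by rewrite muln_gt0.
  by rewrite exprM expr2.
have e := wr _ tt0 nttt.
have z : w * (t * t) + t * t * w = 0.
  have -> : w * (t * t) + t * t * w = (w * t + t * w) * t + t * (w * t + t * w).
    by rewrite mulrDl mulrDr !mulrA; cancel2 D charD.
  by rewrite wr // mulrDl mulrDr !mulrA (add2 charD).
apply: nttt; exists 1%N => //; rewrite expr1; apply: (mulIr (unitD tt0)).
by rewrite mul1r; apply: (eq_add2 charD); rewrite -e z.
Qed.
End ExponentZero.

(** * The theorem *)

Theorem theorem1p3 (D : unitRingType) (divD : division_ring D)
    (ncD : noncommutative D) (charD : 2%N \in [pchar D])
    (n : nat) (f g : {additive D -> D})
    (fg : forall x : D, x != 0 -> f x = x ^+ n * g x^-1) :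
  (n = 2%N -> f =1 g /\ (forall x : D, f x = x * f 1)) /\
  (n <> 2%N -> (forall x : D, f x = 0) /\ (forall x : D, g x = 0)).
Proof.
have fD : {morph f : x y / x + y} by move=> x y; rewrite raddfD.
have gD : {morph g : x y / x + y} by move=> x y; rewrite raddfD.
have gf := inverse_identity_sym divD fg.
split=> [n2|n2]; last first.
  have [nE|n0] := posnP n.
    by subst n; split=> x; [apply: (exponent0_vanish divD charD ncD fD gD)
                           | apply: (exponent0_vanish divD charD ncD gD fD)].
  split=> x.
    exact: (vanish divD charD ncD n0 fD gD fg (value_at1 divD charD ncD n0 fD gD fg n2)).
  exact: (vanish divD charD ncD n0 gD fD gf (value_at1 divD charD ncD n0 gD fD gf n2)).
subst n; pose f' x := f x + x * f 1; pose g' x := g x + x * f 1.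
have f'D : {morph f' : x y / x + y} by move=> x y; rewrite /f' fD mulrDl addrACA.
have g'D : {morph g' : x y / x + y} by move=> x y; rewrite /g' gD mulrDl addrACA.
have fg' : inverse_identity 2 f' g'.
  move=> x x0; rewrite /f' /g' mulrDr -fg //; congr (_ + _).
  by rewrite mulrA expr2 mulrK ?divD.
have gf' := inverse_identity_sym divD fg'.
have f'1 : f' 1 = 0 by rewrite /f' mul1r (add2 charD).
have g'1 : g' 1 = 0 by rewrite -f'1 (inverse_identity_at1 fg').
have fE x : f x = x * f 1.
  exact/(eq_add2 charD)/(vanish divD charD ncD (isT : (0 < 2)%N) f'D g'D fg' f'1).
have gE x : g x = x * f 1.
  exact/(eq_add2 charD)/(vanish divD charD ncD (isT : (0 < 2)%N) g'D f'D gf' g'1).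
by split=> // x; rewrite fE gE.
Qed.
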